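(* Let $\mathcal{D}$ be a weakly self-orthogonal $1$-$(v,k,r)$ design such that $k$ is odd and the block intersection numbers are odd. Let $G$ be an automorphism group of $\mathcal{D}$ acting with $f_1$ fixed points and $n$ point orbits of length $2$, and with $f_2$ fixed blocks and $m$ block orbits of length $2$ (and no other orbits). Let $OM1$ and $OM2$ be, respectively, the submatrix of the orbit matrix indexed by fixed blocks and fixed points, and the submatrix indexed by block orbits and point orbits of length $2$. Then: 1. the binary linear code spanned by the rows of the matrix $[OM1,\ \mathbf{1}]$ is a self-orthogonal code of length $f_1+1$ and dimension $\operatorname{rank}(OM1)$; 2. the binary linear code spanned by the rows of the matrix $OM2$ is a self-orthogonal code of length $n$ and dimension $\operatorname{rank}(OM2)$.
   Context: A $1$-$(v,k,r)$ design is a finite incidence structure with $v$ points such that every block is incident with exactly $k$ points and every point is incident with exactly $r$ blocks. The block intersection numbers are the numbers $|B\cap B'|$ of points incident with both of two different blocks $B\neq B'$; the design is weakly self-orthogonal if all of them have the same parity. An automorphism group of $\mathcal{D}$ is a group of incidence-preserving bijections (points to points, blocks to blocks) of $\mathcal{D}$. The orbit matrix under $G$ has rows indexed by block orbits $\mathcal{B}_i$ and columns by point orbits $\mathcal{V}_j$, with entry $a_{i,j}$ equal to the number of points of $\mathcal{V}_j$ incident with a block of $\mathcal{B}_i$ (independent of the chosen block). Order the orbits so that fixed points (columns $1,\ldots,f_1$) and fixed blocks (rows $1,\ldots,f_2$) come first. Then $OM1=[a_{i,j}]_{1\le i\le f_2,\,1\le j\le f_1}$ and $OM2=[a_{f_2+i,f_1+j}]_{1\le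 i\le m,\,1\le j\le n}$, with entries reduced into $\mathbb{F}_2$ and ranks over $\mathbb{F}_2$. $\mathbf{1}$ is the all-one column, and $[X,Y]$ denotes horizontal concatenation. A code $C\subseteq\mathbb{F}_2^N$ is self-orthogonal if $C\subseteq C^\perp$, where $C^\perp$ is the dual under the standard inner product. *)

(* Defs.v *)
From HB Require Import structures.
From mathcomp Require Import all_boot all_fingroup all_algebra.

Set Implicit Arguments.
Unset Strict Implicit.
Unset Printing Implicit Defensive.

Import GroupScope GRing.Theory.
Local Open Scope ring_scope.

(* A finite incidence structure is given by finite types P of points and B of
   blocks and a relation inc : P -> B -> bool.  Distinct blocks may be incident
   with the same points. *)
Section Designs.

Variables (P B : finType) (inc : P -> B -> bool).

Definition one_design (v k r : nat) : Prop :=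
  [/\ #|P| = v,
      forall b, #|[set p | inc p b]| = k
    & forall p, #|[set b | inc p b]| = r].

Definition block_intersection (b b' : B) : nat :=
  #|[set p | inc p b && inc p b']|.

Definition weakly_self_orthogonal : Prop :=
  forall b1 b2 b3 b4 : B, b1 != b2 -> b3 != b4 ->
    odd (block_intersection b1 b2) = odd (block_intersection b3 b4).

(* An automorphism is a pair of a permutation of the points and a permutation
   of the blocks; an automorphism group is a group G with
   G \subset design_aut inc. *)
Definition design_aut : {set {perm P} * {perm B}} :=
  [set g : {perm P} * {perm B} |
     [forall p, [forall b, inc (g.1 p) (g.2 b) == inc p b]]].

Definition point_group (G : {group {perm P} * {perm B}}) : {group {perm P}} :=
  (@fst {perm P} {perm B} @* G)%G.

Definition block_group (G : {group {perm P} * {perm B}}) : {group {perm B}} :=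
  (@snd {perm P} {perm B} @* G)%G.

(* The number of points of V j incident with a block of W i, the block being
   picked arbitrarily; orbit_matrixE below states that for orbits of an
   automorphism group the choice is irrelevant. *)
Definition orbit_matrix (b c : nat) (V : 'I_c -> {set P}) (W : 'I_b -> {set B})
    : 'M[nat]_(b, c) :=
  \matrix_(i, j) (if [pick x in W i] is Some x
                  then #|[set p in V j | inc p x]| else 0%N).

End Designs.

(* V enumerates, without repetition, all the orbits of H on T: the first f
   are the fixed points of H, the remaining n have length 2. *)
Definition orbit_ordering (T : finType) (H : {group {perm T}}) (f n : nat)
    (V : 'I_(f + n) -> {set T}) : Prop :=
  [/\ injective V,
      forall O : {set T},
        O \in [set orbit 'P H x | x : T] <-> exists j, V j = O,
      forall j : 'I_f, exists2 x, x \in 'Fix_'P(H) & V (lshift n j) = [set x]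
    & forall j : 'I_n, #|V (rshift f j)| = 2%N].

Definition mod2_mx (b c : nat) (A : 'M[nat]_(b, c)) : 'M['F_2]_(b, c) :=
  map_mx (fun a : nat => a%:R) A.

Definition OM1 (f2 m f1 n : nat) (A : 'M[nat]_(f2 + m, f1 + n))
    : 'M['F_2]_(f2, f1) := mod2_mx (ulsubmx A).

Definition OM2 (f2 m f1 n : nat) (A : 'M[nat]_(f2 + m, f1 + n))
    : 'M['F_2]_(m, n) := mod2_mx (drsubmx A).

(* Binary linear codes of length N are the subspaces of 'rV['F_2]_N. *)
Definition row_code (b N : nat) (A : 'M['F_2]_(b, N)) : {vspace 'rV['F_2]_N} :=
  <<[seq row i A | i : 'I_b]>>%VS.

Definition dual_code (N : nat) (C : {vspace 'rV['F_2]_N}) :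
    {set 'rV['F_2]_N} :=
  [set u : 'rV['F_2]_N |
     [forall w : 'rV['F_2]_N, (w \in C) ==> (\sum_j u 0 j * w 0 j == 0)]].

Definition self_orthogonal (N : nat) (C : {vspace 'rV['F_2]_N}) : Prop :=
  {subset C <= dual_code C}.

Lemma orbit_matrixE (P B : finType) (inc : P -> B -> bool)
    (G : {group {perm P} * {perm B}}) (f1 n f2 m : nat)
    (V : 'I_(f1 + n) -> {set P}) (W : 'I_(f2 + m) -> {set B}) i j x :
  G \subset design_aut inc ->
  orbit_ordering (point_group G) V -> orbit_ordering (block_group G) W ->
  x \in W i -> orbit_matrix inc V W i j = #|[set p in V j | inc p x]|.
Proof.
move=> /subsetP autG [_ Vorb _ _] [_ Worb _ _] xW; rewrite mxE.
case: pickP => [y yW|/(_ x)]; last by rewrite xW.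
have /imsetP[b0 _ Wi] : W i \in [set orbit 'P (block_group G) b | b : B].
  by apply/Worb; exists i.
have /imsetP[p0 _ Vj] : V j \in [set orbit 'P (point_group G) p | p : P].
  by apply/Vorb; exists j.
have : x \in orbit 'P (block_group G) y.
  move: xW yW; rewrite Wi => xo yo.
  by rewrite (orbit_in_eqP (subsetT _) yo).
case/orbitP => h /morphimP[g _ gG ->] /= <-; rewrite apermE.
rewrite -(card_imset (mem [set p in V j | inc p y]) (@perm_inj _ g.1)).
apply: eq_card => p; rewrite !inE.
have invg q : inc (g.1 q) (g.2 y) = inc q y.
  by have := autG g gG; rewrite inE => /forallP/(_ q)/forallP/(_ y)/eqP.
have g1 : g.1 \in point_group G by apply/morphimP; exists g; rewrite ?inE.
have Vg q : (g.1 q \in V j) = (q \in V j).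
  by rewrite Vj -[g.1 q]/('P%act q g.1) orbit_actr.
apply/imsetP/andP => [[q]|[pV pI]].
  by rewrite inE => /andP[qV qI] ->; rewrite Vg invg.
exists ((g.1)^-1%g p); last by rewrite permKV.
by rewrite inE -(Vg (_ p)) -(invg (_ p)) permKV pV.
Qed.

(* Main.v *)
Require Import Defs.
From mathcomp Require Import all_boot all_fingroup all_algebra.

(** Write a(i,j) for the entries of the orbit matrix A of the design and d(j,i)
    for those of the orbit matrix A' of the dual incidence structure, i.e. the
    number of blocks of the orbit W i incident with a given point of V j.
    Counting incidences in two ways gives

      - |W i| a(i,j) = |V j| d(j,i)                     (orbit_matrix_dual),
      - for x in W i, the sum over y in W i' of the number of points common to
        x and y is the sum over j of a(i,j) d(j,i')  (sum_block_intersection),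
      - the sum over j of a(i,j) is the block size k (sum_row_orbit_matrix).

    A block meets itself in k points and any other block in an odd number of
    points, so the left side of the second identity has the parity of |W i'|,
    whether or not W i = W i'.

    By the first identity, a(i,j) = 2 d(j,i) is even when W i is a fixed block
    and V j has length 2; d(j,i) = 2 a(i,j) is even when W i has length 2 and
    V j is a fixed point; and d(j,i) = a(i,j) when both lengths agree.  So modulo
    2 only the fixed points contribute to the second identity for two fixed
    blocks, and only the point orbits of length 2 for two block orbits of
    length 2: over the field with two elements, OM1 OM1^T is the all-one matrix
    and OM2 OM2^T = 0.  Adding an all-one column to OM1 adds the all-one matrix
    to its Gram matrix and makes it zero, so both codes are self-orthogonal.

    For the dimensions, the code spanned by the rows of a matrix has dimension
    its rank, and the all-one column does not increase the rank of OM1 because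
    it is the sum of the columns of OM1: by the third identity, the row sums of
    OM1 have the parity of k. *)

Set Implicit Arguments.
Unset Strict Implicit.
Unset Printing Implicit Defensive.

Import GroupScope GRing.Theory.
Local Open Scope ring_scope.

(** * Codes spanned by the rows of a matrix *)

Lemma mem_row_code (b N : nat) (A : 'M['F_2]_(b, N)) (u : 'rV['F_2]_N) :
  (u \in row_code A) = (u <= A)%MS.
Proof.
apply/idP/idP => [/coord_span -> | /submxP[w ->]].
  apply: summx_sub => i _; apply: scalemx_sub.
  have /mapP[l _ ->] :
      (in_tuple [seq row l A | l : 'I_b])`_i \in [seq row l A | l : 'I_b].
    by apply: mem_nth; rewrite size_map -cardE.
  exact: row_sub.
rewrite mulmx_sum_row; apply: memv_suml => i _; apply: memvZ.
by apply: memv_span; apply: map_f; rewrite mem_enum.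
Qed.

Lemma dim_row_code_free (b N : nat) (A : 'M['F_2]_(b, N)) :
  row_free A -> \dim (row_code A) = b.
Proof.
move=> freeA; rewrite /row_code.
have sz : size [seq row i A | i : 'I_b] == b by rewrite size_map size_enum_ord.
suff /eqP -> : free (Tuple sz) by rewrite (eqP sz).
apply/freeP => c c0 i.
have {c0} : \row_l c l *m A = 0 *m A.
  rewrite mul0mx mulmx_sum_row -[RHS]c0; apply: eq_bigr => l _.
  by rewrite mxE /= (nth_map l) ?size_enum_ord // nth_ord_enum.
by move/(row_free_inj freeA)/rowP/(_ i); rewrite !mxE.
Qed.

(** A base of the row space spans the same code, and its rows are linearly
    independent. *)
Lemma dim_row_code (b N : nat) (A : 'M['F_2]_(b, N)) :
  \dim (row_code A) = \rank A.
Proof.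
suff -> : row_code A = row_code (row_base A).
  exact/dim_row_code_free/row_base_free.
by apply/vspaceP => u; rewrite !mem_row_code (eq_row_base A).
Qed.

(** The added columns lie in the column space of M: each of the two matrices is
    the other one times a matrix on the right. *)
Lemma mxrank_row_mx_mul (F : fieldType) (a b c : nat)
    (M : 'M[F]_(a, b)) (N : 'M[F]_(b, c)) :
  \rank (row_mx M (M *m N)) = \rank M.
Proof.
rewrite -{1}[M]mulmx1 -mul_mx_row; apply/eqP.
rewrite eqn_leq mxrankM_maxl.
have {1}-> : M = M *m row_mx 1%:M N *m col_mx 1%:M (0 : 'M_(c, b)).
  by rewrite -mulmxA mul_row_col mulmx0 addr0 !mulmx1.
exact: mxrankM_maxl.
Qed.

(** Vanishing of all products of two rows suffices, since the standard inner
    product is bilinear. *)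
Lemma self_orthogonal_row_code (b N : nat) (A : 'M['F_2]_(b, N)) :
  A *m A^T = 0 -> self_orthogonal (row_code A).
Proof.
move=> AAT0 u; rewrite mem_row_code => /submxP[x ->].
rewrite inE; apply/forallP => w; apply/implyP.
rewrite mem_row_code => /submxP[y ->].
have : (x *m A *m (y *m A)^T) 0 0 = 0.
  by rewrite trmx_mul -mulmxA (mulmxA A) AAT0 mul0mx mulmx0 mxE.
rewrite mxE => sum0; apply/eqP; rewrite -[RHS]sum0.
by apply: eq_bigr => j _; rewrite [_^T _ _]mxE.
Qed.

(** * Orbits of a permutation group *)

Section OrbitOrdering.

Variables (T : finType) (H : {group {perm T}}) (f n : nat).
Variable V : 'I_(f + n) -> {set T}.
Hypothesis ordV : orbit_ordering H V.

Lemma card_orbit_fixed (j : 'I_f) : #|V (lshift n j)| = 1%N.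
Proof. by case: ordV => _ _ /(_ j)[x _ ->] _; rewrite cards1. Qed.

Lemma card_orbit_moved (j : 'I_n) : #|V (rshift f j)| = 2%N.
Proof. by case: ordV. Qed.

Lemma orbit_neq0 j : exists x, x \in V j.
Proof.
case: ordV => _ /(_ (V j)) [_ memV] _ _.
have /imsetP[x _ ->] := memV (ex_intro _ j erefl).
by exists x; apply: orbit_refl.
Qed.

Lemma sum_over_orbits (F : T -> nat) :
  (\sum_x F x = \sum_j \sum_(x in V j) F x)%N.
Proof.
case: ordV => injV memV _ _.
have partV : partition [set orbit 'P H x | x in [set: T]] [set: T].
  by apply: orbit_partition; apply/actsP => h _ x; rewrite !inE.
have -> : (\sum_x F x = \sum_(x in [set: T]) F x)%N.
  by apply: eq_bigl => x; rewrite inE.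
rewrite (set_partition_big _ partV).
rewrite -(big_imset (fun O : {set T} => \sum_(x in O) F x)%N (in2W injV)) /=.
apply: eq_bigl => O; apply/imsetP/imsetP => [[x _ ->] | [j _ ->]].
  by have /memV[j <-] : orbit 'P H x \in [set orbit 'P H y | y : T];
    [apply: imset_f | exists j].
have /imsetP[x _ ->] : V j \in [set orbit 'P H x | x : T].
  by apply/memV; exists j.
by exists x.
Qed.

End OrbitOrdering.

(** * Double counting in the orbit matrix *)

Section OrbitMatrix.

Variables (P B : finType) (inc : P -> B -> bool).
Variables (G : {group {perm P} * {perm B}}) (f1 n f2 m : nat).
Variables (V : 'I_(f1 + n) -> {set P}) (W : 'I_(f2 + m) -> {set B}).
Hypothesis autG : G \subset design_aut inc.
Hypothesis ordV : orbit_ordering (point_group G) V.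
Hypothesis ordW : orbit_ordering (block_group G) W.

Let A := orbit_matrix inc V W.

Let A' := orbit_matrix (fun x p => inc p x) W V.

(** Exchanging the two components of each automorphism turns G into an
    automorphism group of the dual structure, for which point orbits and block
    orbits are interchanged; so the entries of the dual orbit matrix are
    independent of the chosen point for the same reason as those of A. *)
Lemma dual_orbit_matrixE j i p :
  p \in V j -> A' j i = #|[set x in W i | inc p x]|.
Proof.
pose swap (g : {perm P} * {perm B}) := (g.2, g.1).
have swapM : {in G &, {morph swap : g h / (g * h)%g}} by [].
pose Gd := (Morphism swapM @* G)%G.
have GdE h : (h \in Gd) = ((h.2, h.1) \in G).
  apply/morphimP/idP => [[g _ gG ->]|hG]; first by case: g gG.
  by exists (h.2, h.1) => //; case: (h).
have ptGd : point_group Gd = block_group G.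
  apply/val_inj/setP => s; apply/morphimP/morphimP => -[g _ gG ->] /=.
    by rewrite GdE in gG; exists (g.2, g.1); rewrite ?inE.
  by exists (g.2, g.1); rewrite ?inE ?GdE //; case: g gG.
have blGd : block_group Gd = point_group G.
  apply/val_inj/setP => s; apply/morphimP/morphimP => -[g _ gG ->] /=.
    by rewrite GdE in gG; exists (g.2, g.1); rewrite ?inE.
  by exists (g.2, g.1); rewrite ?inE ?GdE //; case: g gG.
apply: (@orbit_matrixE _ _ _ Gd); rewrite ?ptGd ?blGd //.
apply/subsetP => h; rewrite GdE => /(subsetP autG); rewrite !inE /= => /forallP hP.
by apply/forallP => x; apply/forallP => q; have /forallP/(_ x) := hP q.
Qed.

(** Both sides count the incident pairs in V j * W i. *)
Lemma orbit_matrix_dual i j : (#|W i| * A i j = #|V j| * A' j i)%N.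
Proof.
transitivity (\sum_(x in W i) \sum_(p in V j) (inc p x : nat))%N.
  rewrite -sum_nat_const; apply: eq_bigr => x xW.
  rewrite /A (orbit_matrixE _ autG ordV ordW xW) -sum1dep_card big_mkcondr.
  by apply: eq_bigr => p _; case: (inc p x).
rewrite exchange_big -sum_nat_const; apply: eq_bigr => p pV.
rewrite (dual_orbit_matrixE _ pV) -sum1dep_card [RHS]big_mkcondr.
by apply: eq_bigr => x _; case: (inc p x).
Qed.

Lemma sum_row_orbit_matrix i x :
  x \in W i -> (\sum_j A i j = #|[set p | inc p x]|)%N.
Proof.
move=> xW; rewrite -sum1dep_card [RHS]big_mkcond /= (sum_over_orbits ordV).
apply: eq_bigr => j _.
by rewrite /A (orbit_matrixE _ autG ordV ordW xW) -sum1dep_card big_mkcondr.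
Qed.

(** Both sides count the pairs of a point p on x and a block y of W i' through
    p; the right side sorts them by the orbit V j of p. *)
Lemma sum_block_intersection i i' x : x \in W i ->
  (\sum_(y in W i') block_intersection inc x y = \sum_j A i j * A' j i')%N.
Proof.
move=> xW.
transitivity (\sum_p inc p x * #|[set y in W i' | inc p y]|)%N.
  under [RHS]eq_bigr => p _.
    rewrite -sum1dep_card big_mkcondr big_distrr /=; over.
  rewrite exchange_big; apply: eq_bigr => y _.
  rewrite /block_intersection -sum1dep_card big_mkcond.
  by apply: eq_bigr => p _; case: (inc p x); case: (inc p y).
rewrite (sum_over_orbits ordV); apply: eq_bigr => j _.
rewrite /A (orbit_matrixE _ autG ordV ordW xW) -sum1dep_card big_distrl.
rewrite [RHS]big_mkcondr; apply: eq_bigr => p pV.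
by rewrite (dual_orbit_matrixE _ pV) /=; case: (inc p x); rewrite ?mul1n ?mul0n.
Qed.

End OrbitMatrix.

(** * Reduction modulo 2 *)

Lemma natr_F2 (a : nat) : a%:R = (odd a)%:R :> 'F_2.
Proof. by apply/val_inj; rewrite /= !val_Fp_nat // !modn2 oddb. Qed.

Theorem theorem20 (P B : finType) (inc : P -> B -> bool) (v k r : nat)
    (G : {group {perm P} * {perm B}}) (f1 n f2 m : nat)
    (V : 'I_(f1 + n) -> {set P}) (W : 'I_(f2 + m) -> {set B}) :
  one_design inc v k r ->
  weakly_self_orthogonal inc ->
  odd k ->
  (forall b b' : B, b != b' -> odd (block_intersection inc b b')) ->
  G \subset design_aut inc ->
  orbit_ordering (point_group G) V ->
  orbit_ordering (block_group G) W ->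
  let A := orbit_matrix inc V W in
  let C1 := row_code (row_mx (OM1 A) (const_mx 1%R : 'cV['F_2]_f2)) in
  let C2 := row_code (OM2 A) in
  (self_orthogonal C1 /\ \dim C1 = \rank (OM1 A)) /\
  (self_orthogonal C2 /\ \dim C2 = \rank (OM2 A)).
Proof.
move=> [_ cardk _] _ oddk oddI autG ordV ordW A C1 C2.
pose A' := orbit_matrix (fun x p => inc p x) W V.
have AA' i j : (#|W i| * A i j = #|V j| * A' j i)%N.
  exact: orbit_matrix_dual autG ordV ordW i j.
have oddI' x y : odd (block_intersection inc x y).
  have [<-|/oddI//] := eqVneq x y.
  rewrite /block_intersection (_ : [set p | _] = [set p | inc p x]) ?cardk //.
  by apply/setP => p; rewrite !inE andbb.
have sumAA' i i' : (\sum_j A i j * A' j i')%:R = #|W i'|%:R :> 'F_2.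
  have [x xW] := orbit_neq0 ordW i.
  rewrite -(sum_block_intersection autG ordV ordW _ xW) natr_sum -sum1_card.
  rewrite natr_sum; apply: eq_bigr => y _.
  by rewrite natr_F2 oddI'.
have evenA (i : 'I_f2) (j : 'I_n) : (A (lshift m i) (rshift f1 j))%:R = 0 :> 'F_2.
  have := AA' (lshift m i) (rshift f1 j).
  rewrite (card_orbit_fixed ordW) (card_orbit_moved ordV) mul1n => ->.
  by rewrite natr_F2 oddM.
have evenA' (i : 'I_m) (j : 'I_f1) : (A' (lshift n j) (rshift f2 i))%:R = 0 :> 'F_2.
  have := AA' (rshift f2 i) (lshift n j).
  rewrite (card_orbit_moved ordW) (card_orbit_fixed ordV) mul1n => <-.
  by rewrite natr_F2 oddM.
have OM1E i j : OM1 A i j = (A (lshift m i) (lshift n j))%:R.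
  by rewrite mxE [ulsubmx A i j]mxE mxE.
have OM2E i j : OM2 A i j = (A (rshift f2 i) (rshift f1 j))%:R.
  by rewrite mxE [drsubmx A i j]mxE mxE.
have OM1_row_sums : OM1 A *m const_mx 1 = const_mx 1 :> 'cV_f2.
  apply/matrixP => i c; rewrite !mxE.
  have [x xW] := orbit_neq0 ordW (lshift m i).
  have := sum_row_orbit_matrix autG ordV ordW xW.
  rewrite cardk => /(congr1 (fun a => a%:R : 'F_2)).
  rewrite [k%:R]natr_F2 oddk natr_sum big_split_ord /= [X in _ + X]big1 //.
  rewrite addr0 mulr1n => oddrow; rewrite -[RHS]oddrow.
  by apply: eq_bigr => j _; rewrite OM1E [const_mx _ _ _]mxE mulr1.
have OM1_gram : OM1 A *m (OM1 A)^T = const_mx 1.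
  apply/matrixP => i i'; rewrite !mxE.
  have := sumAA' (lshift m i) (lshift m i').
  rewrite (card_orbit_fixed ordW) natr_sum big_split_ord /= [X in _ + X]big1.
    rewrite addr0 mulr1n => oddsum; rewrite -[RHS]oddsum.
    apply: eq_bigr => j _; rewrite natrM.
    have := AA' (lshift m i') (lshift n j).
    rewrite (card_orbit_fixed ordW) (card_orbit_fixed ordV) !mul1n => <-.
    by rewrite [_^T _ _]mxE !OM1E.
  by move=> j _; rewrite natrM evenA mul0r.
have OM2_gram : OM2 A *m (OM2 A)^T = 0.
  apply/matrixP => i i'; rewrite !mxE.
  have := sumAA' (rshift f2 i) (rshift f2 i').
  rewrite (card_orbit_moved ordW) natr_sum big_split_ord /= [X in X + _]big1.
    rewrite add0r [RHS]natr_F2 => evensum; rewrite -[RHS]evensum.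
    apply: eq_bigr => j _; rewrite natrM.
    have := AA' (rshift f2 i') (rshift f1 j).
    rewrite (card_orbit_moved ordW) (card_orbit_moved ordV).
    by move/eqP; rewrite eqn_pmul2l // => /eqP <-; rewrite [_^T _ _]mxE !OM2E.
  by move=> j _; rewrite natrM evenA' mulr0.
split; split; rewrite ?dim_row_code //; last exact: self_orthogonal_row_code.
  apply: self_orthogonal_row_code; rewrite tr_row_mx mul_row_col OM1_gram.
  apply/matrixP => i i'; rewrite !mxE big_ord1 !mxE mulr1.
  by rewrite -[1 + 1]/(2%:R : 'F_2) natr_F2.
by rewrite -OM1_row_sums mxrank_row_mx_mul.
Qed.
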